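(* Let $n\ge 1$, let $\mu$ be a partition of length $\ell(\mu)\leq n$ and let $\delta=(n,n-1,\ldots,1)$, so that $\lambda=\mu+\delta$ (i.e. $\lambda_i=\mu_i+n-i+1$ for $1\le i\le n$) is a strict partition of length $\ell(\lambda)=n$. Let $\mathbf{x}=(x_1,\ldots,x_n)$, $\mathbf{y}=(y_1,\ldots,y_n)$ and $\mathbf{a}=(a_1,a_2,\ldots)$ be sequences of independent parameters. Then $$P_\lambda(\mathbf{x};\mathbf{y}|\mathbf{a}) = \prod_{1\leq i \leq n} x_i \ \prod_{1\leq i<j \leq n} (x_i + y_j)\ s_{\mu} (\mathbf{x}|\mathbf{a})$$ and $$Q_\lambda(\mathbf{x};\mathbf{y}|\mathbf{a}) = \prod_{1\leq i\leq j \leq n} (x_i + y_j)\ s_{\mu} (\mathbf{x}|\mathbf{a}).$$ Equivalently, $$\sum_{P\in\mathcal{P}^\lambda} \mathrm{wgt}(P) = \prod_{1\leq i \leq n} x_i \prod_{1\leq i<j \leq n} (x_i + y_j) \sum_{T\in\mathcal{T}^\mu} \mathrm{wgt}(T)$$ and $$\sum_{Q\in\mathcal{Q}^\lambda} \mathrm{wgt}(Q) = \prod_{1\leq i\leq j \leq n} (x_i + y_j) \sum_{T\in\mathcal{T}^\mu} \mathrm{wgt}(T).$$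
   Context: A partition is a weakly decreasing sequence of non-negative integers; its length $\ell(\lambda)$ is the number of non-zero parts; a partition is strict if its parts $\lambda_1>\lambda_2>\cdots>\lambda_n$ are distinct. Diagrams (matrix coordinates: $i$ is the row, numbered from top to bottom, $j$ the column, from left to right): $F^\mu=\{(i,j): 1\le i\le \ell(\mu),\ 1\le j\le \mu_i\}$. For strict $\lambda$, the shifted diagram is $SF^\lambda=\{(i,j): 1\le i\le\ell(\lambda),\ i\le j\le i+\lambda_i-1\}$. The main diagonal consists of the boxes $(i,i)$. Semistandard tableaux: $\mathcal{T}^\mu$ is the set of all fillings $T=(t_{ij})$ of $F^\mu$ with entries in $\{1<2<\cdots<n\}$ that weakly increase from left to right along rows and strictly increase from top to bottom down columns. Primed shifted tableaux: $\mathcal{Q}^\lambda$ is the set of all fillings of $SF^\lambda$ with entries from the ordered alphabet $1'<1<2'<2<\cdots<n'<n$ such that entries weakly increase from left to right along rows, entries weakly increase from top to bottom down columns, for each $k$ at most one entry $k'$ appears in any row, and for each $k$ at most one (unprimed) entry $k$ appears in any column. $\mathcal{P}^\lambda\subseteq\mathcal{Q}^\lambda$ is the subset of those fillings with no primed entries on the main diagonal. Weights: the weight of a tableau is the product of the weights of its entries over all boxes. - For $T\in\mathcal{T}^\mu$: an entry $t_{ij}=k$ has weight $x_k+a_{k+j-i}$. - For $P\in\mathcal{P}^\lambda$: a diagonal entry $p_{ii}=k$ has weight $x_k$; for $i<j$, $p_{ij}=k$ has weight $x_k+a_{j-i}$ and $p_{ij}=k'$ has weight $y_k-a_{j-i}$.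 - For $Q\in\mathcal{Q}^\lambda$: a diagonal entry $q_{ii}=k$ has weight $x_k$ and $q_{ii}=k'$ has weight $y_k$; for $i<j$, $q_{ij}=k$ has weight $x_k+a_{j-i}$ and $q_{ij}=k'$ has weight $y_k-a_{j-i}$. The factorial Schur function is $s_\mu(\mathbf{x}|\mathbf{a})=\sum_{T\in\mathcal{T}^\mu}\mathrm{wgt}(T)$, and the factorial generalised Schur $P$- and $Q$-functions are $P_\lambda(\mathbf{x};\mathbf{y}|\mathbf{a})=\sum_{P\in\mathcal{P}^\lambda}\mathrm{wgt}(P)$ and $Q_\lambda(\mathbf{x};\mathbf{y}|\mathbf{a})=\sum_{Q\in\mathcal{Q}^\lambda}\mathrm{wgt}(Q)$. *)

(* Defs.v *)
(* Plain MathComp. *)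
From HB Require Import structures.
From mathcomp Require Import all_boot all_order all_algebra.

Set Implicit Arguments.
Unset Strict Implicit.
Unset Printing Implicit Defensive.

Import GRing.Theory.

Local Open Scope nat_scope.

(* A partition is a list of natural numbers; trailing zeros are allowed. *)
Definition is_partition (mu : seq nat) : bool := sorted geq mu.

Definition is_strict_partition (la : seq nat) : bool := sorted gtn la.

(* Parts, rows and columns are numbered from 1, so [part mu 0] is not used. *)
Definition part (mu : seq nat) (i : nat) : nat := nth 0 mu i.-1.

Definition plength (mu : seq nat) : nat := count (fun m => m != 0) mu.

Definition add_staircase (n : nat) (mu : seq nat) : seq nat :=
  [seq part mu i + (n - i + 1) | i <- iota 1 n].

Definition diagram (mu : seq nat) : seq (nat * nat) :=
  [seq (i, j) | i <- iota 1 (plength mu), j <- iota 1 (part mu i)].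

(* [iota i (part la i)] is the range i <= j <= i + la_i - 1. *)
Definition shifted_diagram (la : seq nat) : seq (nat * nat) :=
  [seq (i, j) | i <- iota 1 (plength la), j <- iota i (part la i)].

Definition filling (D : seq (nat * nat)) (E : finType) := {ffun seq_sub D -> E}.

Definition brow (D : seq (nat * nat)) (b : seq_sub D) : nat := (val b).1.
Definition bcol (D : seq (nat * nat)) (b : seq_sub D) : nat := (val b).2.

(* The letter k of {1 < ... < n} is the ordinal of value k - 1. *)
Definition letter (n : nat) (k : 'I_n) : nat := k.+1.

Definition is_semistandard (n : nat) (mu : seq nat)
    (T : filling (diagram mu) 'I_n) : bool :=
  [forall b, forall c,
     ((brow b == brow c) && (bcol b < bcol c) ==> (T b <= T c))
  && ((bcol b == bcol c) && (brow b < brow c) ==> (T b < T c))].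

(* The pair (k, true) is the primed letter k', and (k, false) is k. *)
Definition pletter (n : nat) : finType := ('I_n * bool)%type.

Definition primed (n : nat) (e : pletter n) : bool := e.2.

(* Position of a letter in 1' < 1 < 2' < 2 < ... < n' < n, from 0. *)
Definition prank (n : nat) (e : pletter n) : nat := (e.1).*2 + ~~ primed e.

Definition is_Qtableau (n : nat) (la : seq nat)
    (Q : filling (shifted_diagram la) (pletter n)) : bool :=
  [forall b, forall c,
    [&& (brow b == brow c) && (bcol b < bcol c) ==> (prank (Q b) <= prank (Q c)),
        (bcol b == bcol c) && (brow b < brow c) ==> (prank (Q b) <= prank (Q c)),
        [&& brow b == brow c, Q b == Q c & primed (Q b)] ==> (b == c)
      & [&& bcol b == bcol c, Q b == Q c & ~~ primed (Q b)] ==> (b == c)]].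

Definition is_Ptableau (n : nat) (la : seq nat)
    (P : filling (shifted_diagram la) (pletter n)) : bool :=
  is_Qtableau P && [forall b, (brow b == bcol b) ==> ~~ primed (P b)].

Local Open Scope ring_scope.

(* Here [a k] is a_k for k >= 1, and [a 0] never occurs: column strictness
   forces letter (T b) >= brow b in a semistandard tableau, hence the truncated
   subtraction below is exact with a positive result. *)
Definition wgt (R : comNzRingType) (n : nat) (mu : seq nat)
    (x : 'I_n -> R) (a : nat -> R) (T : filling (diagram mu) 'I_n) : R :=
  \prod_b (x (T b) + a (letter (T b) + bcol b - brow b)%N).

(* A tableau without primes on the diagonal never meets the weight y_k, so this
   weight serves for both the P- and the Q-functions. *)
Definition shifted_wgt (R : comNzRingType) (n : nat) (la : seq nat)
    (x y : 'I_n -> R) (a : nat -> R)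
    (Q : filling (shifted_diagram la) (pletter n)) : R :=
  \prod_b
    let k := (Q b).1 in
    if brow b == bcol b then (if primed (Q b) then y k else x k)
    else if primed (Q b) then y k - a (bcol b - brow b)%N
    else x k + a (bcol b - brow b)%N.

Definition factorial_schur (R : comNzRingType) (n : nat) (mu : seq nat)
    (x : 'I_n -> R) (a : nat -> R) : R :=
  \sum_(T : filling (diagram mu) 'I_n | is_semistandard T) wgt x a T.

Definition factorial_P (R : comNzRingType) (n : nat) (la : seq nat)
    (x y : 'I_n -> R) (a : nat -> R) : R :=
  \sum_(P : filling (shifted_diagram la) (pletter n) | is_Ptableau P)
    shifted_wgt x y a P.

Definition factorial_Q (R : comNzRingType) (n : nat) (la : seq nat)
    (x y : 'I_n -> R) (a : nat -> R) : R :=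
  \sum_(Q : filling (shifted_diagram la) (pletter n) | is_Qtableau Q)
    shifted_wgt x y a Q.

(* Main.v *)
(** Let (z|a)^l = (z + a_1) ... (z + a_l). With l_i = mu_i + n - i, the sum over
    semistandard tableaux times the Vandermonde product Delta(x) is
    det ((x_i|a)^(l_j)), and the sum over primed tableaux times Delta(x) is
    prod_j (x_j + u_j) prod_(i < j) (x_i + y_j) times the same determinant, where
    u_k is the weight of k' on the main diagonal (u = y for Q and u = 0 for P).
    Both follow by induction on the number m of letters. Removing the boxes with
    the last letter leaves an interlacing shape k, with l_(j+1) <= k_j <= l_j, and
    the weight of the removed boxes is a product over rows, so by multilinearity
    the sum over k is one determinant of size m; its entries telescope to those
    obtained from the determinant of size m + 1 by the column operations that
    clear its last row. Delta(x) may be a zero divisor in R, so x_i is first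
    replaced by x_i + t^(i + 1) in R[t], where Delta is, up to sign, a product of
    monic polynomials; the result is then evaluated at t = 0. *)
Require Import Defs.
From mathcomp Require Import all_boot all_order perm all_algebra zify ring.

Set Implicit Arguments.
Unset Strict Implicit.
Unset Printing Implicit Defensive.

Import GRing.Theory.
Local Open Scope ring_scope.

(** * Determinants: multilinearity and clearing a row *)

(** In the expansion over permutations each column contributes a sum over its own index;
    distributing the product of these sums gives a sum over choices [k]. *)
Lemma det_sum_columns (R : comNzRingType) m (K : finType) (P : 'I_m -> pred K)
    (v : 'I_m -> K -> R) (F : 'I_m -> 'I_m -> K -> R) :
  \det (\matrix_(i < m, j < m) \sum_(k | P j k) v j k * F i j k) =
  \sum_(k : {ffun 'I_m -> K} | [forall j, P j (k j)])
     (\prod_j v j (k j)) * \det (\matrix_(i < m, j < m) F i j (k j)).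
Proof.
under [RHS]eq_bigr => k _ do rewrite -det_tr mulr_sumr.
rewrite -det_tr exchange_big /=; apply: eq_bigr => s _.
under eq_bigr => j _ do rewrite !mxE.
rewrite (bigA_distr_big_dep P (fun j k => v j k * F (s j) j k)) mulr_sumr.
apply: eq_big => [k|k _]; first by apply/familyP/forallP.
rewrite big_split /= mulrCA; congr (_ * (_ * _)).
by apply: eq_bigr => j _; rewrite !mxE.
Qed.

(** The unitriangular [U] keeps the determinant and clears the last row up to its final entry, so
    the expansion along that row has one term. *)
Lemma det_cancel_last_row (R : comNzRingType) (G : nat -> nat -> R)
    (rho : nat -> R) m :
  (forall j, (j < m)%N -> G m j = rho j * G m j.+1) ->
  \det (\matrix_(i < m.+1, j < m.+1) G i j) =
  G m m * \det (\matrix_(i < m, j < m) (G i j - rho j * G i j.+1)).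
Proof.
move=> Gm.
pose A := \matrix_(i < m.+1, j < m.+1) G i j.
(* U subtracts rho j times column j.+1 from column j. *)
pose U := \matrix_(k < m.+1, j < m.+1)
  ((k == j :> nat)%:R - (k == j.+1 :> nat)%:R * rho j).
have detU : \det U = 1.
  rewrite det_trig; last first.
    apply/is_trig_mxP => i j ij; rewrite !mxE.
    by rewrite (ltn_eqF ij) (ltn_eqF (ltnW _)) ?mul0r ?subr0.
  by apply: big1 => i _; rewrite !mxE eqxx ltn_eqF // mul0r subr0.
(* The last column has no right neighbour; [(j < m)%:R] switches its correction off. *)
have AU (i j : 'I_m.+1) :
    (A *m U) i j = G i j - (j < m)%:R * (rho j * G i j.+1).
  rewrite !mxE; under eq_bigr => k _ do rewrite !mxE mulrBr.
  rewrite sumrB; congr (_ - _).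
    rewrite (bigD1 j) //= eqxx mulr1 big1 ?addr0 // => k /negbTE kj.
    by rewrite val_eqE kj mulr0.
  case: ltnP => jm.
    rewrite (bigD1 (Ordinal (jm : j.+1 < m.+1)%N)) //= eqxx !mul1r mulrC.
    rewrite big1 ?addr0 // => k kj; suff -> : (k == j.+1 :> nat) = false by rewrite mul0r mulr0.
    by apply/negbTE; apply: contra kj => /eqP kj; apply/eqP/val_inj.
  rewrite mul0r big1 // => k _; suff -> : (k == j.+1 :> nat) = false by rewrite mul0r mulr0.
  by apply/negbTE/eqP => kj; have := ltn_ord k; rewrite kj ltnS ltnNge jm.
rewrite -[LHS]mulr1 -detU -det_mulmx (expand_det_row _ ord_max).
rewrite (bigD1 ord_max) //= [X in _ + X]big1 ?addr0 => [|j jm]; last first.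
  have {}jm : (j < m)%N.
    by rewrite ltn_neqAle -ltnS ltn_ord andbT; apply: contra jm => /eqP jm; apply/eqP/val_inj.
  by rewrite AU jm mul1r -Gm // subrr mul0r.
rewrite AU /= ltnn mul0r subr0 /cofactor -signr_odd /= oddD addbb mul1r.
congr (_ * \det _); apply/matrixP => i j.
by rewrite mxE mxE AU mxE !lift_max ltn_ord mul1r.
Qed.

(** * Induction on the number of letters *)

Section VandermondeInduction.

Variables (R : comNzRingType) (a : nat -> R).

(* The factorial power (z|a)^hi divided by (z|a)^lo. *)
Definition apow (lo hi : nat) (z : R) : R := \prod_(lo <= t < hi) (z + a t.+1).

(* The shapes at stage m: partitions with at most m parts if s is false, strict
   partitions with exactly m parts if s is true; p i is the length of row i, rows
   being numbered from 0. *)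
Definition row_lengths (s : bool) (N m : nat) (p : nat -> nat) : bool :=
  [forall i : 'I_m,
     [&& (p i < N)%N, (s <= p i)%N & (i.+1 < m)%N ==> (p i.+1 + s <= p i)%N]].

Definition rows m N (q : {ffun 'I_m -> 'I_N}) (i : nat) : nat :=
  if insub i is Some j then q j else 0%N.

Lemma rowsE m N (q : {ffun 'I_m -> 'I_N}) (i : 'I_m) : rows q i = q i.
Proof. by rewrite /rows valK. Qed.

Definition interlace m N (p : nat -> nat) (q : {ffun 'I_m -> 'I_N}) : bool :=
  [forall i : 'I_m, (p i.+1 <= q i <= p i)%N].

(* The exponent l_i of the determinant, as a function of the length q of row i. *)
Definition expo (s : bool) (m i q : nat) : nat :=
  if s then q.-1 else (q + (m - i.+1))%N.

Lemma row_lengths_lt s N m p i : row_lengths s N m p -> (i < m)%N -> (p i < N)%N.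
Proof. by move=> /forallP h im; case/and3P: (h (Ordinal im)). Qed.

Lemma row_lengths_ge s N m p i : row_lengths s N m p -> (i < m)%N -> (s <= p i)%N.
Proof. by move=> /forallP h im; case/and3P: (h (Ordinal im)). Qed.

Lemma row_lengths_succ s N m p i :
  row_lengths s N m p -> (i.+1 < m)%N -> (p i.+1 + s <= p i)%N.
Proof.
by move=> /forallP h im; case/and3P: (h (Ordinal (ltnW im))) => _ _ /implyP; apply.
Qed.

(* The non-strict k have two equal columns in the determinant, which is why they
   can be added to the sum over strict interlacing shapes. *)
Lemma interlace_equal_expo s N m p (q : {ffun 'I_m -> 'I_N}) :
  row_lengths s N m.+1 p -> interlace p q -> ~~ row_lengths s N m (rows q) ->
  exists i j : 'I_m, i != j /\ expo s m i (q i) = expo s m j (q j).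
Proof.
move=> hp /forallP hq; rewrite negb_forall => /existsP[i].
rewrite rowsE ltn_ord /= negb_and.
have /andP[q1 q2] := hq i.
have hp1 := row_lengths_ge hp (ltn_ord i : i.+1 < m.+1)%N.
rewrite (leq_trans hp1 q1) /= negb_imply => /andP[im].
rewrite (rowsE q (Ordinal im)) => hlt.
have /andP[q3 q4] := hq (Ordinal im).
case: s hp hp1 hlt => [hp hp1 hlt|hp _ /=]; last first.
  by rewrite addn0 (leq_trans q4 q1).
exists i, (Ordinal im); split; first by rewrite -val_eqE /= ltn_eqF.
rewrite /expo /=; move: hlt; rewrite -ltnNge /= in q4 *; lia.
Qed.

Variables (n N : nat) (s : bool) (x : nat -> R).
(** [Phi m p] stands for the sum over tableaux of shape [p] with [m] letters, [w m i p' p q] for the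
    weight of the boxes removed when row [i] shrinks from [p] to [q] above a row of length [p']. *)
Variables (Phi : nat -> (nat -> nat) -> R) (c : nat -> R) (g : nat -> R -> R).
Variable w : nat -> nat -> nat -> nat -> nat -> R.

Hypothesis Phi0 : forall p, Phi 0%N p = 1.
Hypothesis PhiS : forall m p, (m < n)%N -> row_lengths s N m.+1 p ->
  Phi m.+1 p = c m * apow 0 (expo s m.+1 m (p m)) (x m) *
    \sum_(q : {ffun 'I_m -> 'I_N} | interlace p q && row_lengths s N m (rows q))
       (\prod_(i < m) w m i (p i.+1) (p i) (q i)) * Phi m (rows q).
(** One matrix entry: scaled by [X - x m], the sum over the new lengths of row [i] becomes [g m X]
    times the entry left by the column operations. *)
Hypothesis w_sum : forall m i p' p X, (i < m)%N -> (m < n)%N ->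
  (s <= p')%N -> (p' + s <= p)%N -> (p < N)%N ->
  (X - x m) * \sum_(q < N | (p' <= q <= p)%N)
      w m i p' p q * apow 0 (expo s m i q) X =
  g m X * (apow 0 (expo s m.+1 i p) X -
           apow (expo s m.+1 i.+1 p') (expo s m.+1 i p) (x m) *
           apow 0 (expo s m.+1 i.+1 p') X).

Lemma vandermonde_branching m p : (m <= n)%N -> row_lengths s N m p ->
  (\prod_(j < m) \prod_(i < j) (x i - x j)) * Phi m p =
  (\prod_(j < m) (c j * \prod_(i < j) g j (x i))) *
  \det (\matrix_(i < m, j < m) apow 0 (expo s m j (p j)) (x i)).
Proof.
elim: m p => [|m IH] p mn hp; first by rewrite !big_ord0 Phi0 det_mx00.
rewrite PhiS // !big_ord_recr /=.
set V := \prod_(j < m) _; set C := \prod_(j < m) (c j * _).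
(* The last row has variable [x m], where the factorial powers of consecutive columns differ by a
   quotient [apow]; this quotient is [rho j]. *)
rewrite (@det_cancel_last_row R
  (fun i j => apow 0 (expo s m.+1 j (p j)) (x i))
  (fun j => apow (expo s m.+1 j.+1 (p j.+1)) (expo s m.+1 j (p j)) (x m))); last first.
  move=> j jm; rewrite mulrC -big_cat_nat //=.
  have := row_lengths_succ hp (jm : j.+1 < m.+1)%N; rewrite /expo.
  by case: (s) => /=; lia.
set S := \sum_(q | _) _; set f := apow 0 _ _.
set D := \det _.
(* With [c m * f] taken out, the new Vandermonde factors scale the rows of one determinant and the
   [g m (x i)] those of the other. *)
suff e : \prod_(i < m) (x i - x m) * (V * S) = C * (\prod_(i < m) g m (x i) * D).
  transitivity (c m * f * (\prod_(i < m) (x i - x m) * (V * S))); first by ring.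
  by rewrite e; ring.
have -> : V * S = C * \det (\matrix_(i < m, j < m)
   \sum_(q < N | (p j.+1 <= q <= p j)%N)
      w m j (p j.+1) (p j) q * apow 0 (expo s m j q) (x i)).
  rewrite (det_sum_columns (fun (j : 'I_m) (q : 'I_N) => p j.+1 <= q <= p j)%N
    (fun j q => w m j (p j.+1) (p j) q)
    (fun i j q => apow 0 (expo s m j q) (x i))).
  rewrite [in RHS](bigID (fun q => row_lengths s N m (rows q))) /=.
  rewrite [X in _ + X]big1 ?addr0 => [|q /andP[hq1 hq2]]; last first.
    have [i [j [ij eij]]] := interlace_equal_expo hp hq1 hq2.
    rewrite -det_tr (determinant_alternate ij) ?mulr0 // => k.
    by rewrite !mxE eij.
  rewrite /S mulr_sumr mulr_sumr; apply: eq_bigr => q /andP[_ hq].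
  rewrite mulrCA IH // 1?ltnW //.
  under [in LHS]eq_mx => i j do rewrite rowsE.
  by rewrite mulrCA.
rewrite mulrCA; congr (_ * _).
have scale (A : 'M[R]_m) (d : 'I_m -> R) :
    \prod_i d i * \det A = \det (\matrix_(i, j) (d i * A i j)).
  transitivity (\det (diag_mx (\row_i d i) *m A)).
    by rewrite det_mulmx det_diag; under [in RHS]eq_bigr => i _ do rewrite mxE.
  congr (\det _); apply/matrixP => i j.
  by rewrite mul_diag_mx !mxE.
rewrite !scale; congr (\det _); apply/matrixP => i j; rewrite !mxE.
apply: w_sum => //.
- by apply: (row_lengths_ge hp); rewrite ltnS.
- by apply: (row_lengths_succ hp); rewrite ltnS.
- by apply: (row_lengths_lt hp); apply: ltnW; rewrite ltnS.
Qed.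

End VandermondeInduction.

(** * Removing the last letter *)

Section Branching.

Variables (R : comNzRingType) (n N : nat) (s : bool).
Notation box := ('I_n * 'I_N)%type.
Variables (E : finType) (lv : E -> nat) (e0 : E).
Variable compat : box -> box -> E -> E -> bool.
Variable wt : box -> E -> R.

(* The box (i, c) is the c-th one of row i, from 0, so s = true shifts row i by i. *)
Definition column (b : box) : nat := (b.2 + s * b.1)%N.

Definition before (b c : box) : bool :=
  ((b.1 == c.1) && (b.2 < c.2)%N) || ((column b == column c) && (b.1 < c.1)%N).

Definition row_diagram (m : nat) (p : nat -> nat) : {set box} :=
  [set b : box | (b.1 < m)%N && (b.2 < p b.1)%N].

Definition compatible (S : {set box}) (T : {ffun box -> E}) : bool :=
  [forall b in S, forall c in S, compat b c (T b) (T c)].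

(** Off the shape a filling takes the default [e0], so tableaux of all shapes live in one finite
    type. The lower bound on levels confines letters below [m] to the first [m] rows. *)
Definition tableau (m : nat) (S : {set box}) (T : {ffun box -> E}) : bool :=
  (T \in pfamily e0 (mem S) (fun b : box => [pred e | (b.1 <= lv e < m)%N])) && compatible S T.

Definition top_tableau (m : nat) (S : {set box}) (T : {ffun box -> E}) : bool :=
  (T \in pfamily e0 (mem S) (fun b => [pred e | lv e == m])) && compatible S T.

Definition tableau_sum m p : R :=
  \sum_(T | tableau m (row_diagram m p) T) \prod_(b in row_diagram m p) wt b (T b).

Definition top_sum m (S : {set box}) : R :=
  \sum_(T | top_tableau m S T) \prod_(b in S) wt b (T b).

(** Together with [compat_lt] this makes compatibility of letters of different levels a condition on
    the boxes alone: the one of larger level must not come [before] the other. *)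
Hypothesis compat_before : forall b c e e',
  before b c -> compat b c e e' -> (lv e <= lv e')%N.
Hypothesis compat_lt : forall b c e e',
  (lv e < lv e')%N -> ~~ before c b -> compat b c e e' && compat c b e' e.
(* Down one row at fixed position in the row, the letter's level grows; this
   bounds levels below by rows and forces the interlacing. *)
Hypothesis compat_diag : forall (b b' d : box) (T : {ffun box -> E}),
  b'.1 = b.1 -> b'.2 = (b.2 + s)%N :> nat -> d.1 = b.1.+1 :> nat -> d.2 = b.2 ->
  compat b b' (T b) (T b') -> compat b' d (T b') (T d) -> (lv (T b) < lv (T d))%N.

Lemma compatibleP (S : {set box}) (T : {ffun box -> E}) :
  reflect {in S &, forall b c, compat b c (T b) (T c)} (compatible S T).
Proof.
apply: (iffP forall_inP) => [h b c bS cS | h b bS].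
  exact: (forall_inP (h b bS)).
by apply/forall_inP => c cS; apply: h.
Qed.

(** The box [b'] in the row of [b] and the column of [d] links the two. It is [b] itself for
    ordinary shapes and the right neighbour of [b] for shifted ones, where strictness of the shape
    puts it in the diagram. *)
Lemma compatible_diag m p (T : {ffun box -> E}) (b d : box) :
  row_lengths s N m p -> compatible (row_diagram m p) T -> d \in row_diagram m p ->
  d.1 = b.1.+1 :> nat -> d.2 = b.2 -> (lv (T b) < lv (T d))%N.
Proof.
move=> hp /compatibleP hT dS db1 db2.
have := dS; rewrite inE => /andP[dm dp].
have bm : (b.1.+1 < m)%N by rewrite -db1.
have bp : (d.2 + s < p b.1)%N.
  by apply: leq_trans (row_lengths_succ hp bm); rewrite -db1 -addSn leq_add2r.
have b'N : (b.2 + s < N)%N.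
  by rewrite -db2; apply: ltn_trans bp (row_lengths_lt hp (ltnW bm)).
pose b' : box := (b.1, Ordinal b'N).
apply: (@compat_diag b b' d) => //.
  apply: hT; rewrite inE /= (ltnW bm) /= -db2 //.
  by apply: leq_ltn_trans bp; rewrite leq_addr.
by apply: hT; rewrite // inE /= (ltnW bm) -db2.
Qed.

Lemma compatible_row_le m p (T : {ffun box -> E}) (b : box) :
  row_lengths s N m p -> compatible (row_diagram m p) T -> b \in row_diagram m p ->
  (b.1 <= lv (T b))%N.
Proof.
move=> hp hT; case: b => [[i im] c] /=.
elim: i im => // i IH im bS.
apply: leq_ltn_trans (IH (ltnW im) _) (compatible_diag hp hT bS _ _) => //.
move: bS; rewrite !inE /= => /andP[i1 i2].
rewrite (ltnW i1); apply: leq_trans i2 _.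
by apply: leq_trans (row_lengths_succ hp i1); rewrite leq_addr.
Qed.

Lemma row_diagram_rows_inj m (q q' : {ffun 'I_m -> 'I_N}) : (m <= n)%N ->
  row_diagram m (rows q) = row_diagram m (rows q') -> q = q'.
Proof.
move=> mn /setP e; apply/ffunP => i; apply/val_inj.
have H c (cN : (c < N)%N) : (c < q i)%N = (c < q' i)%N.
  have := e (widen_ord mn i, Ordinal cN).
  by rewrite !inE /= ltn_ord !rowsE.
have := H _ (ltn_ord (q i)); have := H _ (ltn_ord (q' i)).
rewrite /=; move: (nat_of_ord (q i)) (nat_of_ord (q' i)) => u v.
by rewrite !ltnn; lia.
Qed.

(** Levels grow weakly along rows, so the small entries fill an initial segment of each row. The
    segment lengths interlace with [p] because each box has a larger level than the one above it at
    the same position. *)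
Lemma small_entries m p (T : {ffun box -> E}) : (m < n)%N -> row_lengths s N m.+1 p ->
  tableau m.+1 (row_diagram m.+1 p) T ->
  exists2 q : {ffun 'I_m -> 'I_N}, interlace p q && row_lengths s N m (rows q) &
    [set b in row_diagram m.+1 p | (lv (T b) < m)%N] = row_diagram m (rows q).
Proof.
move=> mn hp /andP[/familyP hT cT]; set S := row_diagram m.+1 p in hT cT *.
set U := [set b in S | _].
pose len (i : nat) := \max_(b in U | b.1 == i :> nat) b.2.+1.
have lenp i : (len i <= p i)%N.
  apply/bigmax_leqP => b /andP[+ /eqP <-]; rewrite inE => /andP[+ _].
  by rewrite inE => /andP[].
have lenN (i : 'I_m) : (len i < N)%N.
  exact: leq_ltn_trans (lenp i) (row_lengths_lt hp (leqW (ltn_ord i))).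
pose q := [ffun i : 'I_m => Ordinal (lenN i)].
have inU (b : box) : b \in S -> (b \in U) = (b.2 < len b.1)%N.
  move=> bS; apply/idP/idP => [bU|].
    by apply: (@leq_bigmax_cond _ _ (fun b : box => b.2.+1) b); rewrite bU eqxx.
  rewrite ltnNge; apply: contraNT => bU; apply/bigmax_leqP => c /andP[cU /eqP cb].
  rewrite ltnNge; apply: contra bU => bc.
  have := cU; rewrite inE => /andP[cS cm]; rewrite inE bS /=.
  apply: leq_ltn_trans cm; move: bc; rewrite leq_eqVlt => /orP[/eqP bc|bc].
    by rewrite (_ : b = c) //; case: (b) (c) bc cb => [? ?] [? ?] /= /val_inj-> /val_inj->.
  apply: (@compat_before b c); last exact: (compatibleP _ _ cT).
  by rewrite /before bc andbT; apply/orP; left; apply/eqP/val_inj.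
have rowm (b : box) : b \in U -> (b.1 < m)%N.
  rewrite inE => /andP[bS bm]; apply: leq_ltn_trans bm.
  by have := hT b; rewrite /= bS inE => /andP[].
have Uq : U = row_diagram m (rows q).
  apply/setP => b; have [bS|bS] := boolP (b \in S).
    rewrite [RHS]inE; have [bm|bm] /= := ltnP b.1 m.
      by rewrite inU // (rowsE q (Ordinal bm)) ffunE.
    by apply/negbTE/negP => /rowm; rewrite ltnNge bm.
  rewrite inE (negbTE bS) /=; apply/esym/negbTE; apply: contra bS.
  rewrite !inE => /andP[bm]; rewrite (rowsE q (Ordinal bm)) ffunE /= (leqW bm) => bl.
  exact: leq_trans bl (lenp _).
have lenge i : (i < m)%N -> (p i.+1 <= len i)%N.
  move=> im; case pi: (p i.+1) => [//|c].
  have cp : (c < p i.+1)%N by rewrite pi.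
  have cN : (c < N)%N by apply: ltn_trans cp (row_lengths_lt hp _).
  pose d : box := (Ordinal (leq_ltn_trans im mn), Ordinal cN).
  pose b : box := (Ordinal (ltn_trans im mn), Ordinal cN).
  have dS : d \in S by rewrite inE /= ltnS im.
  have bS : b \in S.
    rewrite inE /= (leqW im); apply: leq_trans cp _.
    by apply: leq_trans (row_lengths_succ hp (im : i.+1 < m.+1)%N); rewrite leq_addr.
  rewrite -(inU b bS) inE bS /=.
  apply: leq_trans (compatible_diag hp cT dS _ _) _ => //.
  by have := hT d; rewrite /= dS inE => /andP[].
exists q => //; apply/andP; split.
  by apply/forallP => i; rewrite ffunE /= lenp lenge.
apply/forallP => i; rewrite rowsE ffunE lenN /=.
have -> /= : (s <= len i)%N.
  by apply: leq_trans (lenge _ (ltn_ord i)); apply: (row_lengths_ge hp); rewrite ltnS.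
apply/implyP => im; rewrite (rowsE q (Ordinal im)) ffunE /=.
have l1 : (len i.+1 <= len i)%N by apply: leq_trans (lenp _) (lenge _ (ltn_ord i)).
case hs: s => /=; last by rewrite addn0.
rewrite addn1 ltn_neqAle l1 andbT; apply/eqP => el.
(* Equal segments would both have length p_(i+1). The last small box [d] of row [i.+1] then lies
   right below the first box [b] after the segment of row [i], which forces [b] to be small too. *)
have lp : len i = p i.+1.
  by apply/eqP; rewrite eqn_leq lenge // -el lenp.
have l0 : (0 < len i.+1)%N.
  by apply: leq_trans (lenge _ im); have := row_lengths_ge hp (im : i.+2 < m.+1)%N; rewrite hs.
have cN1 : ((len i.+1).-1 < N)%N.
  by rewrite prednK // ltnW // (lenN (Ordinal im)).
pose d : box := (Ordinal (ltn_trans im mn), Ordinal cN1).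
pose b : box := (widen_ord (ltnW mn) i, Ordinal (lenN i)).
have bS : b \in S.
  rewrite inE /= leqW //= lp.
  have := row_lengths_succ hp (ltn_ord i : i.+1 < m.+1)%N.
  by rewrite hs addn1.
have dU : d \in U.
  rewrite inU; first by rewrite /= prednK.
  by rewrite inE /= leqW //= prednK.
have : b \in U.
  move: dU; rewrite inE => /andP[dS dm]; rewrite inE bS /=.
  apply: leq_ltn_trans dm; apply: (@compat_before b d); last exact: (compatibleP _ _ cT).
  apply/orP; right; rewrite /= ltnSn andbT /column hs /= !mul1n -el.
  by apply/eqP; lia.
by rewrite inU //= ltnn.
Qed.

(** Gluing is a bijection from pairs formed by a tableau on the small shape and a filling of the
    strip by last letters; the weight is multiplicative over the disjoint union. *)
Lemma top_tableau_split m p (q : {ffun 'I_m -> 'I_N}) :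
  (m < n)%N -> row_lengths s N m.+1 p -> interlace p q -> row_lengths s N m (rows q) ->
  \sum_(T | tableau m.+1 (row_diagram m.+1 p) T &&
            ([set b in row_diagram m.+1 p | (lv (T b) < m)%N] == row_diagram m (rows q)))
     \prod_(b in row_diagram m.+1 p) wt b (T b) =
  tableau_sum m (rows q) * top_sum m (row_diagram m.+1 p :\: row_diagram m (rows q)).
Proof.
move=> mn hp /forallP pq hq; rewrite /tableau_sum.
set S := row_diagram m.+1 p; set S1 := row_diagram m (rows q).
set S2 := S :\: S1.
have S1S b : b \in S1 -> b \in S.
  rewrite !inE => /andP[bm]; rewrite (rowsE q (Ordinal bm)) (leqW bm) => bq.
  by apply: leq_trans bq _; have /andP[] := pq (Ordinal bm).
have rowsP i j : (i < j)%N -> (j < m)%N -> (rows q j + s * (j - i) <= rows q i)%N.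
  move=> ij jm; elim: j ij jm => // j IH; rewrite ltnS leq_eqVlt => /orP[/eqP <-|ij] jm.
    by rewrite subSnn muln1 (row_lengths_succ hq).
  have := row_lengths_succ hq jm; have := IH ij (ltnW jm).
  rewrite (subSn (ltnW ij)) mulnS; lia.
(* No strip box comes before a box of the small shape, so by [compat_lt] every pair taken across the
   two parts is compatible. *)
have ideal b c : b \in S1 -> c \in S2 -> ~~ before c b.
  rewrite !inE => /andP[bm bq] /and3P[+ cm cp]; rewrite negb_and.
  apply: contraL => /orP[/andP[/eqP -> cb]|/andP[/eqP + cb]].
    by rewrite negb_or !negbK bm /= (ltn_trans cb bq).
  rewrite negb_or !negbK (ltn_trans cb bm) /column => e.
  have := rowsP _ _ cb bm; rewrite mulnBr; nia.
have inS2 b : (b \in S2) = (b \notin S1) && (b \in S) by rewrite inE.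
have Srow b : b \in S -> (b.1 < m.+1)%N by rewrite inE => /andP[].
clearbody S2 S1 S; rewrite /top_sum big_distrlr /= pair_big /=.
pose glue (P : {ffun box -> E} * {ffun box -> E}) :=
  [ffun b => if b \in S1 then P.1 b else P.2 b].
pose restr (A : {set box}) (T : {ffun box -> E}) :=
  [ffun b => if b \in A then T b else e0].
rewrite (reindex_onto glue (fun T => (restr S1 T, restr S2 T))) /=; last first.
  move=> T /andP[/andP[/familyP hT _] _]; apply/ffunP => b; rewrite !ffunE /=.
  have [b1|b1] // := boolP (b \in S1); rewrite inS2 b1 /=; case: ifP => // bS.
  by have := hT b; rewrite /= bS inE => /eqP.
apply: eq_big => [[T1 T2]|[T1 T2] /andP[/andP[_ /eqP hU] _]] /=; last first.
  rewrite (bigID (mem S1)) /=; congr (_ * _).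
    rewrite (eq_bigl (fun b => b \in S1)) => [|b].
      by apply: eq_bigr => b bS1; rewrite ffunE bS1.
    by rewrite /= andb_idl //; apply: S1S.
  rewrite (eq_bigl (fun b => b \in S2)) => [|b]; last by rewrite /= inS2 andbC.
  by apply: eq_bigr => b; rewrite inS2 => /andP[/negbTE bS1 _]; rewrite ffunE /= bS1.
apply/idP/idP.
  move=> /andP[/andP[/andP[/familyP hT /compatibleP cT] /eqP/setP hU]].
  rewrite xpair_eqE => /andP[/eqP e1 /eqP e2].
  have g1 b : b \in S1 -> glue (T1, T2) b = T1 b by move=> b1; rewrite ffunE b1.
  have g2 b : b \in S2 -> glue (T1, T2) b = T2 b.
    by rewrite inS2 => /andP[/negbTE b1 _]; rewrite ffunE b1.
  apply/andP; split; apply/andP; split.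
  - apply/familyP => b /=; have [b1|b1] := boolP (b \in S1); last first.
      by rewrite -e1 ffunE (negbTE b1) !inE.
    have := hT b; have := hU b; rewrite /= !inE (S1S _ b1) b1 g1 //=.
    by move=> -> /andP[-> _].
  - by apply/compatibleP => b c b1 c1; rewrite -!g1 //; apply: cT; apply: S1S.
  - apply/familyP => b /=; have [b2|b2] := boolP (b \in S2); last first.
      by rewrite -e2 ffunE (negbTE b2) !inE.
    have := b2; rewrite inS2 => /andP[b1 bS].
    have := hT b; have := hU b; rewrite /= !inE bS (negbTE b1) g2 //=.
    by move=> /negbT; rewrite -leqNgt => mT /andP[_ Tm]; rewrite eqn_leq mT andbT.
  - apply/compatibleP => b c b2 c2; rewrite -!g2 //; apply: cT.
      by move: b2; rewrite inS2 => /andP[].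
    by move: c2; rewrite inS2 => /andP[].
move=> /andP[/andP[/familyP h1 /compatibleP c1] /andP[/familyP h2 /compatibleP c2]].
have h1' b : b \in S1 -> (b.1 <= lv (T1 b) < m)%N.
  by move=> b1; have := h1 b; rewrite /= b1.
have h2' b : b \in S2 -> lv (T2 b) = m.
  by move=> b2; have := h2 b; rewrite /= b2 inE => /eqP.
have SU b : b \in S -> b \in S1 \/ b \in S2.
  by move=> bS; have [b1|b1] := boolP (b \in S1); [left | right; rewrite inS2 b1].
have g1 b : b \in S1 -> glue (T1, T2) b = T1 b by move=> b1; rewrite ffunE b1.
have g2 b : b \in S2 -> glue (T1, T2) b = T2 b.
  by rewrite inS2 => /andP[/negbTE b1 _]; rewrite ffunE b1.
apply/andP; split; [apply/andP; split; [apply/andP; split|]|].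
- apply/familyP => b /=; have [bS|bS] := boolP (b \in S); last first.
    rewrite ffunE /=; case: ifP => b1; first by rewrite S1S in bS.
    by have := h2 b; rewrite /= inS2 b1 (negbTE bS).
  rewrite !inE; have [b1|b2] := SU b bS.
    by rewrite g1 //; case/andP: (h1' b b1) => -> /leqW ->.
  rewrite g2 // h2' // ltnSn andbT.
  exact: Srow.
- apply/compatibleP => b c bS cS.
  have [b1|b2] := SU b bS; have [d1|d2] := SU c cS.
  + by rewrite !g1 //; apply: c1.
  + rewrite g1 // g2 //.
    suff /andP[] : compat b c (T1 b) (T2 c) && compat c b (T2 c) (T1 b) by [].
    apply: compat_lt; last exact: ideal.
    by rewrite h2' //; case/andP: (h1' b b1).
  + rewrite g2 // g1 //.
    suff /andP[] : compat c b (T1 c) (T2 b) && compat b c (T2 b) (T1 c) by [].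
    apply: compat_lt; last exact: ideal.
    by rewrite h2' //; case/andP: (h1' c d1).
  + by rewrite !g2 //; apply: c2.
- apply/eqP/setP => b; rewrite inE; have [bS|bS] /= := boolP (b \in S); last first.
    by apply/esym/negbTE; apply: contra bS; apply: S1S.
  have [b1|b2] := SU b bS.
    by rewrite g1 // b1; case/andP: (h1' b b1).
  by rewrite g2 // h2' // ltnn; move: b2; rewrite inS2 => /andP[/negbTE].
- rewrite xpair_eqE; apply/andP; split; apply/eqP/ffunP => b; rewrite ffunE.
    case: ifP => b1; first exact: g1.
    by have := h1 b; rewrite /= b1 inE => /eqP.
  case: ifP => b2; first exact: g2.
  by have := h2 b; rewrite /= b2 inE => /eqP.
Qed.

(** Each tableau is counted under the unique [q] whose diagram is the set of its boxes of level
    below [m]. *)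
Lemma tableau_branching m p : (m < n)%N -> row_lengths s N m.+1 p ->
  tableau_sum m.+1 p =
  \sum_(q : {ffun 'I_m -> 'I_N} | interlace p q && row_lengths s N m (rows q))
    tableau_sum m (rows q) * top_sum m (row_diagram m.+1 p :\: row_diagram m (rows q)).
Proof.
move=> mn hp; rewrite /(tableau_sum m.+1).
pose small (T : {ffun box -> E}) := [set b in row_diagram m.+1 p | (lv (T b) < m)%N].
transitivity (\sum_(T | tableau m.+1 (row_diagram m.+1 p) T)
   \sum_(q : {ffun 'I_m -> 'I_N} | (interlace p q && row_lengths s N m (rows q))
      && (small T == row_diagram m (rows q)))
     \prod_(b in row_diagram m.+1 p) wt b (T b)).
  apply: eq_bigr => T hT; have [q hq eq] := small_entries mn hp hT.
  rewrite (big_pred1 q) // => q' /=; apply/idP/eqP => [/andP[_ /eqP eq']|-> /=].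
    by apply: (row_diagram_rows_inj (ltnW mn)); rewrite -eq' -eq.
  by rewrite hq /small eq eqxx.
rewrite (exchange_big_dep (fun q => interlace p q && row_lengths s N m (rows q))) /=; last first.
  by move=> T q _ /andP[].
apply: eq_bigr => q /andP[h1 h2]; rewrite -top_tableau_split //.
by apply: eq_bigl => T; rewrite h1 h2.
Qed.

Lemma tableau_sum0 p : tableau_sum 0 p = 1.
Proof.
have S0 : row_diagram 0 p = set0 by apply/setP => b; rewrite !inE.
rewrite /tableau_sum S0 (big_pred1 [ffun _ => e0]).
  by rewrite big_set0.
move=> T /=; apply/idP/eqP => [/andP[/familyP hT _]|->].
  by apply/ffunP => b; have := hT b; rewrite /= !inE ffunE => /eqP.
apply/andP; split; last by apply/compatibleP => b c; rewrite inE.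
by apply/familyP => b; rewrite /= !inE ffunE.
Qed.

End Branching.

(** * Products over strips *)

Lemma big_ord_interval (T : Type) (idx : T) (op : Monoid.com_law idx)
    N lo hi (F : nat -> T) : (hi <= N)%N ->
  \big[op/idx]_(c < N | (lo <= c < hi)%N) F c = \big[op/idx]_(lo <= c < hi) F c.
Proof.
move=> hN; rewrite big_geq_mkord /=.
by rewrite (big_ord_widen_cond _ (fun c => (lo <= c)%N) F hN).
Qed.

Lemma prod_skew_diagram (R : comNzRingType) n N m p q (g : nat -> nat -> R) :
  (m < n)%N -> (forall i, (i <= m)%N -> (p i <= N)%N) ->
  \prod_(b in row_diagram n N m.+1 p :\: row_diagram n N m q) g b.1 b.2 =
  (\prod_(0 <= c < p m) g m c) * \prod_(i < m) \prod_(q i <= c < p i) g i c.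
Proof.
move=> mn pN; pose lo i := if (i < m)%N then q i else 0%N.
transitivity (\prod_(i < n | (i < m.+1)%N) \prod_(c < N | (lo i <= c < p i)%N) g i c).
  rewrite pair_big_dep /=; apply: eq_bigl => -[i c]; rewrite !inE /= /lo.
  by case: (ltnP i m) => im //=; rewrite -leqNgt (leqW im).
rewrite -(big_ord_widen_cond n xpredT
  (fun i => \prod_(c < N | (lo i <= c < p i)%N) g i c) mn) /=.
rewrite big_ord_recr mulrC /= (@big_ord_interval _ _ _ _ _ _ (g m)) ?pN //.
rewrite [lo m]/lo ltnn; congr (_ * _); apply: eq_bigr => i _.
by rewrite (@big_ord_interval _ _ _ _ _ _ (g i)) ?pN 1?ltnW // /lo ltn_ord.
Qed.

(** When the last letters can be chosen independently from box to box, the sum over fillings factors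
    over the boxes. *)
Lemma top_sum_family (R : comNzRingType) n N (E : finType) (lv : E -> nat) e0
    (compat : 'I_n * 'I_N -> 'I_n * 'I_N -> E -> E -> bool) (wt : _ -> E -> R)
    m (S : {set 'I_n * 'I_N}) (F : 'I_n * 'I_N -> pred E) :
  top_tableau lv e0 compat m S =1 [pred T in pfamily e0 (mem S) F] ->
  top_sum lv e0 compat wt m S = \prod_(b in S) \sum_(e | F b e) wt b e.
Proof.
move=> h; rewrite /top_sum (big_distr_big_dep e0).
by apply: eq_bigl => T; rewrite h.
Qed.

(** * Identities for factorial powers *)

Section FactorialPowers.

Variables (R : comNzRingType) (a : nat -> R).

Lemma apow_recr lo hi z : (lo <= hi)%N ->
  apow a lo hi.+1 z = apow a lo hi z * (z + a hi.+1).
Proof. by move=> h; rewrite /apow big_nat_recr. Qed.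

Lemma apow_recl lo hi z : (lo < hi)%N ->
  apow a lo hi z = (z + a lo.+1) * apow a lo.+1 hi z.
Proof. by move=> h; rewrite /apow big_ltn. Qed.

Lemma apow_nn lo z : apow a lo lo z = 1.
Proof. by rewrite /apow big_geq. Qed.

(** Writing X - z as (X + a_(k+1)) - (z + a_(k+1)) makes each summand a difference [f k.+1 - f k],
    and the sum telescopes. *)
Lemma apow_divided_difference lo hi z X : (lo <= hi)%N ->
  (X - z) * \sum_(lo <= k < hi) apow a k.+1 hi z * apow a 0 k X =
  apow a 0 hi X - apow a lo hi z * apow a 0 lo X.
Proof.
move=> h; rewrite mulr_sumr.
pose f k := apow a k hi z * apow a 0 k X.
rewrite (eq_big_nat _ _ (F2 := fun k => f k.+1 - f k)) => [|k /andP[_ k2]].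
  by rewrite telescope_sumr // /f apow_nn mul1r.
by rewrite /f (apow_recl _ k2) apow_recr //; ring.
Qed.

(** The left side sums over the strips in one row of a shifted shape: forced prime, free start,
    empty strip. On the right X + y = (y - a_(k+1)) + (X + a_(k+1)); shifting the second half by one
    step merges neighbours into z + y. *)
Lemma apow_strip_sum lo hi z y X : (lo < hi)%N ->
  (y - a lo.+1) * apow a lo.+1 hi z * apow a 0 lo X
  + \sum_(lo.+1 <= k < hi) (z + y) * apow a k.+1 hi z * apow a 0 k X
  + apow a 0 hi X =
  (X + y) * \sum_(lo <= k < hi) apow a k.+1 hi z * apow a 0 k X.
Proof.
move=> h; transitivity (\sum_(lo <= k < hi)
  ((y - a k.+1) * apow a k.+1 hi z * apow a 0 k X + apow a k.+1 hi z * apow a 0 k.+1 X)).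
  rewrite big_split /= [X in _ = X + _]big_ltn // -!addrA; congr (_ + _).
  case: hi h => // hi; rewrite ltnS => h.
  rewrite [X in _ = _ + X]big_nat_recr //= apow_nn mul1r addrA; congr (_ + _).
  rewrite big_add1 /= [X in _ = X + _]big_add1 /= -big_split /=.
  by apply: eq_big_nat => k /andP[_ kh]; rewrite (@apow_recl k.+1 hi.+1) //; ring.
by rewrite mulr_sumr; apply: eq_bigr => k _; rewrite apow_recr //; ring.
Qed.

End FactorialPowers.

(** * Semistandard tableaux *)

Section Semistandard.

Variables (R : comNzRingType) (n N : nat) (x a : nat -> R).
Notation box := ('I_n.+1 * 'I_N)%type.

Definition ss_compat (b c : box) (e e' : 'I_n.+1) : bool :=
  ((b.1 == c.1) && (b.2 < c.2)%N ==> (e <= e')%N)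
  && ((b.2 == c.2) && (b.1 < c.1)%N ==> (e < e')%N).

Definition ss_weight (b : box) (e : 'I_n.+1) : R :=
  x e + a (e.+1 + b.2 - b.1)%N.

Definition ss_sum := @tableau_sum R n.+1 N _ (@nat_of_ord n.+1) ord0 ss_compat ss_weight.

Lemma ss_compat_before (b c : box) e e' :
  before false b c -> ss_compat b c e e' -> (e <= e')%N.
Proof.
rewrite /before /column !mul0n !addn0 /ss_compat.
move=> /orP[->|/andP[/eqP/val_inj -> ->]] /andP[] //=.
by rewrite eqxx => _ /ltnW.
Qed.

Lemma ss_compat_lt (b c : box) (e e' : 'I_n.+1) :
  (e < e')%N -> ~~ before false c b -> ss_compat b c e e' && ss_compat c b e' e.
Proof.
move=> ee'; rewrite /before /column !mul0n !addn0 negb_or => /andP[h1 h2].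
rewrite /ss_compat (ltnW ee') ee' !implybT /= (negbTE h1) /=.
by rewrite -val_eqE (negbTE h2).
Qed.

Lemma ss_compat_diag (b b' d : box) (T : {ffun box -> 'I_n.+1}) :
  b'.1 = b.1 -> b'.2 = (b.2 + false)%N :> nat -> d.1 = b.1.+1 :> nat -> d.2 = b.2 ->
  ss_compat b b' (T b) (T b') -> ss_compat b' d (T b') (T d) -> (T b < T d)%N.
Proof.
move=> b1 b2 d1 d2 _ /andP[_]; rewrite addn0 in b2.
have -> : b' = b by move: b b' b1 b2 {d1 d2} => [? ?] [? ?] /= -> /val_inj ->.
by rewrite d2 eqxx d1 ltnSn.
Qed.

(** Interlacing makes the removed boxes a horizontal strip, which has exactly one filling by the
    last letter. In row [i] box [c] weighs [x m + a (m.+1 + c - i)], whence the shift of the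
    exponents. *)
Lemma ss_top_sum m p (q : {ffun 'I_m -> 'I_N}) :
  (m < n.+1)%N -> row_lengths false N m.+1 p -> interlace p q ->
  top_sum (@nat_of_ord n.+1) ord0 ss_compat ss_weight m
    (row_diagram n.+1 N m.+1 p :\: row_diagram n.+1 N m (rows q)) =
  apow a 0 (p m) (x m) *
  \prod_(i < m) apow a (q i + (m - i.+1)).+1 (p i + (m - i.+1)).+1 (x m).
Proof.
move=> mn hp pq; set S := _ :\: _.
(* If [c] lay below [b] in the same column, then c.2 < p_(c.1) <= p_(b.1+1) <= q_(b.1), so [b] would
   belong to the smaller diagram. *)
have strip (b c : box) : b \in S -> c \in S -> b.2 = c.2 -> ~~ (b.1 < c.1)%N.
  rewrite !inE negb_and => /andP[+ /andP[bm _]] /andP[_ /andP[cm cp]] bc.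
  have pmono i j : (i <= j)%N -> (j <= m)%N -> (p j <= p i)%N.
    move=> ij; elim: j ij => [|j IH]; first by rewrite leqn0 => /eqP->.
    rewrite leq_eqVlt => /orP[/eqP->//|ij jm].
    apply: leq_trans (IH _ _); rewrite ?(ltnW jm) //.
    by have := row_lengths_succ hp (jm : j.+1 < m.+1)%N; rewrite addn0.
  apply: contraL => bc1; have bm' : (b.1 < m)%N by apply: leq_trans bc1 _.
  rewrite bm' /= negbK bc (rowsE q (Ordinal bm')).
  have /andP[h _] := forallP pq (Ordinal bm').
  by apply: leq_trans h; apply: leq_trans cp (pmono _ _ _ _).
rewrite (@top_sum_family _ _ _ _ _ _ _ _ _ _ (fun _ => pred1 (Ordinal mn))); last first.
  move=> T; rewrite /= inE; apply/andP/familyP.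
    move=> [/familyP hT _] b; have := hT b; rewrite /=.
    by case: ifP => // _; rewrite !inE.
  move=> hT; have hT' b : b \in S -> T b = Ordinal mn.
    by move=> bS; have := hT b; rewrite /= bS => /eqP.
  split.
    apply/familyP => b; have := hT b; rewrite /=.
    by case: ifP => // _; rewrite !inE => /eqP ->.
  apply/compatibleP => b c bS cS; rewrite /ss_compat !hT' //= leqnn implybT /=.
  by rewrite ltnn implybF negb_and; case: eqP => //= bc; apply: strip => //; rewrite bc.
under eq_bigr => b _ do rewrite big_pred1_eq.
rewrite (prod_skew_diagram (rows q) (fun i c => x m + a (m.+1 + c - i)%N) mn); last first.
  by move=> i im; apply/ltnW/(row_lengths_lt hp).
congr (_ * _).
  by apply: eq_big_nat => c _; rewrite addSn subSn ?leq_addr // addKn.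
apply: eq_bigr => i _; rewrite rowsE /apow -!addSn.
set d := (m - i.+1)%N.
rewrite big_addn addnK big_add1 /=; apply: eq_bigr => c _.
by congr (_ + a _); have := ltn_ord i; rewrite /d; lia.
Qed.

Lemma ss_vandermonde m p : (m <= n.+1)%N -> row_lengths false N m p ->
  (\prod_(j < m) \prod_(i < j) (x i - x j)) * ss_sum m p =
  \det (\matrix_(i < m, j < m) apow a 0 (expo false m j (p j)) (x i)).
Proof.
move=> mn hp.
rewrite (@vandermonde_branching R a n.+1 N false x ss_sum (fun=> 1) (fun _ _ => 1)
  (fun m i p' p q => apow a (q + (m - i.+1)).+1 (p + (m - i.+1)).+1 (x m))) //.
- by rewrite big1 ?mul1r // => j _; rewrite big1 ?mul1r.
- by move=> p'; apply: tableau_sum0.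
- move=> k p' kn hp'; rewrite /ss_sum (@tableau_branching R _ _ false) //.
  + rewrite mul1r mulr_sumr; apply: eq_bigr => q /andP[q1 q2].
    rewrite ss_top_sum // /expo subnn addn0 mulrC -mulrA; congr (_ * (_ * _)).
  + exact: ss_compat_before.
  + exact: ss_compat_lt.
  + exact: ss_compat_diag.
- move=> k i p' q X ik kn _; rewrite addn0 => pq qN.
  rewrite (@big_ord_interval _ _ _ N p' q.+1 (fun c => apow a (c + (k - i.+1)).+1
     (q + (k - i.+1)).+1 (x k) * apow a 0 (expo false k i c) X)) // /expo.
  (* Shifted by [d], the summation range becomes that of the divided difference, whose ends are the
     exponents of rows [i.+1] and [i] at stage [k.+1]. *)
  set d := (k - i.+1)%N; have -> : (k.+1 - i.+1)%N = d.+1 by rewrite /d subnSK.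
  rewrite subSS -/d mul1r addnS -apow_divided_difference ?leq_add2r 1?leqW ?leq_add2r //.
  by rewrite -addSn big_addn addnK.
Qed.

End Semistandard.

(** * Primed shifted tableaux *)

Section Primed.

Variables (R : comNzRingType) (n N : nat) (x y u a : nat -> R).
Notation box := ('I_n.+1 * 'I_N)%type.

Definition ps_compat (b c : box) (e e' : pletter n.+1) : bool :=
  [&& (b.1 == c.1) && (b.2 < c.2)%N ==> (prank e <= prank e')%N,
      (column true b == column true c) && (b.1 < c.1)%N ==> (prank e <= prank e')%N,
      [&& b.1 == c.1, e == e' & primed e] ==> (b == c)
    & [&& column true b == column true c, e == e' & ~~ primed e] ==> (b == c)].

Definition ps_weight (b : box) (e : pletter n.+1) : R :=
  if b.2 == 0%N :> nat then (if primed e then u e.1 else x e.1)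
  else if primed e then y e.1 - a b.2 else x e.1 + a b.2.

Definition plevel (e : pletter n.+1) : nat := e.1.

Definition ps_sum :=
  @tableau_sum R n.+1 N _ plevel (ord0, true) ps_compat ps_weight.

Lemma prank_level (e e' : pletter n.+1) :
  (prank e <= prank e')%N -> (plevel e <= plevel e')%N.
Proof. by rewrite /prank /plevel; case: (~~ primed e) (~~ primed e') => -[] /=; lia. Qed.

Lemma level_prank (e e' : pletter n.+1) :
  (plevel e < plevel e')%N -> (prank e <= prank e')%N.
Proof. by rewrite /prank /plevel; case: (~~ primed e) (~~ primed e') => -[] /=; lia. Qed.

Lemma ps_compat_before b c e e' :
  before true b c -> ps_compat b c e e' -> (plevel e <= plevel e')%N.
Proof.
rewrite /ps_compat => /orP[] -> /and4P[] r1 r2 _ _; exact: prank_level.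
Qed.

Lemma ps_compat_lt b c e e' : (plevel e < plevel e')%N -> ~~ before true c b ->
  ps_compat b c e e' && ps_compat c b e' e.
Proof.
move=> lt; rewrite negb_or => /andP[/negbTE h1 /negbTE h2].
have /negbTE ne : e != e' by apply: contraTneq lt => ->; rewrite ltnn.
by rewrite /ps_compat h1 h2 [e' == e]eq_sym ne !andbF (level_prank lt) !implybT.
Qed.

(** If [b] and [d] had the same level, [b'] would share it. A primed [b'] then makes [b] repeat the
    primed letter in the row, an unprimed [b'] makes [d] repeat the letter in the column. *)
Lemma ps_compat_diag (b b' d : box) (T : {ffun box -> pletter n.+1}) :
  b'.1 = b.1 -> b'.2 = (b.2 + true)%N :> nat -> d.1 = b.1.+1 :> nat -> d.2 = b.2 ->
  ps_compat b b' (T b) (T b') -> ps_compat b' d (T b') (T d) ->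
  (plevel (T b) < plevel (T d))%N.
Proof.
move=> b1 b2 d1 d2 /and4P[r1 _ r3 _] /and4P[_ s2 _ s4].
have cd : column true b' == column true d.
  by rewrite /column b2 b1 d1 d2 /=; apply/eqP; lia.
have ne : b == b' = false.
  by apply/eqP => e; move: b2; rewrite -e; lia.
have ne' : b' == d = false.
  by apply/eqP => e; move: d1; rewrite -e b1; lia.
move: r1 r3 s2 s4; rewrite cd ne ne' b1 b2 d1 eqxx ltnSn addn1 ltnSn /=.
rewrite !implybF => r1 r3 r2 r4; rewrite ltnNge; apply/negP => le.
have := conj (prank_level r1) (prank_level r2).
move: r1 r2 r3 r4 le; rewrite /prank /plevel /primed.
case: (T b) (T b') (T d) => [i []] [j []] [k []] //=;
  rewrite ?xpair_eqE /= ?andbT ?andbF -?val_eqE /=; lia.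
Qed.


End Primed.

Lemma pletter_eq n (e e' : pletter n) :
  e.1 = e'.1 -> primed e = primed e' -> e = e'.
Proof. by case: e e' => [i s] [j t] /= -> ->. Qed.

Section PrimedTop.

Variables (R : comNzRingType) (n N : nat) (x y u a : nat -> R).
Notation box := ('I_n.+1 * 'I_N)%type.
Variables (m : nat) (p : nat -> nat) (q : {ffun 'I_m -> 'I_N}).
Hypotheses (mn : (m < n.+1)%N) (hp : row_lengths true N m.+1 p).
Hypotheses (pq : interlace p q) (hq : row_lengths true N m (rows q)).

Definition strip : {set box} := row_diagram n.+1 N m.+1 p :\: row_diagram n.+1 N m (rows q).

Definition strip_start (i : nat) : nat := if (i < m)%N then rows q i else 0%N.

(** Such a box starts the strip in its row and has another strip box right below it, where an
    unprimed letter would recur. *)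
Definition forced_primed (i c : nat) : bool :=
  [&& (i < m)%N, c == rows q i & c == p i.+1].

Definition top_letters (b : box) : pred (pletter n.+1) := fun e =>
  (e.1 == Ordinal mn) &&
  (if primed e then b.2 == strip_start b.1 :> nat else ~~ forced_primed b.1 b.2).

Lemma in_strip (b : box) :
  (b \in strip) = [&& (b.1 <= m)%N, (strip_start b.1 <= b.2)%N & (b.2 < p b.1)%N].
Proof.
rewrite !inE /strip_start ltnS; case: (ltnP b.1 m) => bm /=; last by [].
by rewrite (ltnW bm) -leqNgt.
Qed.

Lemma rows_bounds i : (i < m)%N ->
  [&& (0 < rows q i)%N, (p i.+1 <= rows q i)%N & (rows q i <= p i)%N].
Proof.
by move=> im; rewrite (row_lengths_ge hq im) (rowsE q (Ordinal im)) (forallP pq (Ordinal im)).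
Qed.

Lemma p_decr i j : (i < j <= m)%N -> (p j + (j - i) <= p i)%N.
Proof.
move=> /andP[ij jm]; elim: j ij jm => // j IH; rewrite ltnS leq_eqVlt => /orP[/eqP <-|ij] jm.
  by have := row_lengths_succ hp (jm : i.+1 < m.+1)%N; rewrite subSnn.
by have := row_lengths_succ hp (jm : j.+1 < m.+1)%N; have := IH ij (ltnW jm); lia.
Qed.

(** In a row of the strip a prime can stand only at the start, and it is optional there unless a
    strip box lies right below. These conditions are independent from box to box, which lets the sum
    factor. *)
Lemma top_tableau_primed :
  top_tableau (@plevel n) (ord0, true) (@ps_compat n N) m strip =1
  [pred T in pfamily (ord0, true) (mem strip) top_letters].
Proof.
move=> T; rewrite /= inE; apply/andP/familyP.
  move=> [/familyP hT /compatibleP cT].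
  have lev b : b \in strip -> (T b).1 = Ordinal mn.
    by move=> bS; have := hT b; rewrite /= bS inE => /eqP e; apply/val_inj.
  move=> b /=; have := hT b; rewrite /=; case: ifP => // bS _.
  suff : top_letters b (T b) by []; rewrite /top_letters lev // eqxx /=.
  have := bS; rewrite in_strip => /and3P[bm bl bp].
  case Tb: (primed (T b)).
    rewrite eqn_leq bl andbT leqNgt; apply/negP => lb.
    have cN : (b.2.-1 < N)%N by apply: leq_ltn_trans (leq_pred _) (ltn_ord _).
    pose c : box := (b.1, Ordinal cN).
    have cS : c \in strip by rewrite in_strip /= bm; lia.
    have := cT c b cS bS; rewrite /ps_compat eqxx /=.
    have lt : (b.2.-1 < b.2)%N by rewrite prednK ?leqnn // (leq_ltn_trans _ lb).
    rewrite lt => /and4P[+ _ + _]; rewrite /prank lev // lev //= Tb.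
    rewrite leq_add2l; case Tc: (primed (T c)) => //= _.
    have -> : T c == T b.
      by apply/eqP/pletter_eq; rewrite ?lev // Tb.
    by move=> /eqP/(congr1 (fun z : box => val z.2)) /= e; rewrite e ltnn in lt.
  apply/negP => /and3P[im /eqP bq /eqP bp1].
  have /and3P[q0 _ _] := rows_bounds im.
  (* The box [d] right below [b] is in the strip; its rank is no smaller than that of the unprimed
     letter, so the letter recurs in the column. *)
  have dN : (b.2.-1 < N)%N by apply: leq_ltn_trans (leq_pred _) (ltn_ord _).
  pose d : box := (Ordinal (leq_ltn_trans im mn), Ordinal dN).
  have dS : d \in strip.
    rewrite in_strip /= im /= /strip_start; apply/andP; split; last by lia.
    by case: ifP => // im2; have := row_lengths_succ hq im2; lia.
  have cd : column true b == column true d by rewrite /column /=; lia.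
  have := cT b d bS dS; rewrite /ps_compat cd ltnSn /= => /and4P[_ + _].
  rewrite /prank !lev //= Tb leq_add2l; case Td: (primed (T d)) => //= _.
  have -> : T b == T d.
    by apply/eqP/pletter_eq; rewrite ?lev // Tb.
  by move=> /eqP/(congr1 (fun z : box => val z.1)) /= e; lia.
move=> hT.
have hS b : b \in strip -> top_letters b (T b) by move=> bS; have := hT b; rewrite /= bS.
have lev b : b \in strip -> (T b).1 = Ordinal mn by move=> /hS /andP[/eqP].
have start b : b \in strip -> primed (T b) -> b.2 = strip_start b.1 :> nat.
  by move=> /hS /andP[_]; case: ifP => // _ /eqP.
have forced b : b \in strip -> forced_primed b.1 b.2 -> primed (T b).
  by move=> /hS /andP[_]; case: ifP => // _ /negbTE ->.
(* When two strip boxes share a column, interlacing and strictness of [p] squeeze the upper one: it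
   starts the strip in its row at position p_(b.1+1), so its prime is forced. *)
have above b c : b \in strip -> c \in strip -> column true b = column true c ->
    (b.1 < c.1)%N -> primed (T b).
  move=> bS cS e bc; apply: forced => //.
  move: bS cS; rewrite !in_strip => /and3P[bm bl bp] /and3P[cm cl cp].
  have im : (b.1 < m)%N by apply: leq_trans bc cm.
  move: bl; rewrite /forced_primed /strip_start im /=.
  have /and3P[q0 q1 q2] := rows_bounds im.
  have : (p c.1 + (c.1 - b.1.+1) <= p b.1.+1)%N.
    move: bc; rewrite leq_eqVlt => /orP[/eqP <-|bc]; first by rewrite subnn addn0.
    by apply: p_decr; rewrite bc.
  move: e; rewrite /column /= !mul1n.
  move: bc cp q1; move: (p c.1) (p b.1.+1) (rows q b.1) => pc pb rb.
  move: (nat_of_ord b.1) (nat_of_ord b.2) (nat_of_ord c.1) (nat_of_ord c.2) => b1 b2 c1 c2.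
  lia.
split.
  apply/familyP => b; have := hT b; rewrite /=; case: ifP => bS //.
  by rewrite !inE => /andP[/eqP e _]; rewrite /plevel e.
apply/compatibleP => b c bS cS; apply/and4P; split; apply/implyP.
- move=> /andP[/eqP bc lt]; rewrite /prank !lev //= leq_add2l.
  case Tc: (primed (T c)); last by case: (primed _).
  have := start c cS Tc; move: bS; rewrite in_strip bc => /and3P[_ le _] e.
  by rewrite -e leqNgt lt in le.
- move=> /andP[/eqP bc lt]; rewrite /prank !lev //= leq_add2l.
  by rewrite (above b c).
- move=> /and3P[/eqP bc /eqP e Tb].
  have Tc : primed (T c) by rewrite -e.
  rewrite [b]surjective_pairing [c]surjective_pairing bc xpair_eqE eqxx /=.
  by apply/eqP/val_inj; rewrite /= (start b) // (start c) // bc.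
- move=> /and3P[/eqP bc /eqP e Tb].
  have [lt|lt|eq] := ltngtP b.1 c.1.
  + by rewrite (above b c) in Tb.
  + by rewrite e (above c b) in Tb.
  + move: bc; rewrite /column /= eq => /addIn/val_inj e2.
    by rewrite [b]surjective_pairing [c]surjective_pairing e2 (val_inj eq).
Qed.

(** At a free start both letters are allowed and the parameter cancels: (y - a) + (x + a) = x + y.
    Row [m] starts on the diagonal, where the prime weighs [u m]. *)
Definition strip_factor (i c : nat) : R :=
  if (i < m)%N then
    if c == rows q i then (if c == p i.+1 then y m - a c else x m + y m) else x m + a c
  else if c == 0%N then x m + u m else x m + a c.

Lemma sum_top_letters b : b \in strip ->
  \sum_(e | top_letters b e) ps_weight x y u a b e = strip_factor b.1 b.2.
Proof.
rewrite in_strip => /and3P[bm bl bp].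
pose om := Ordinal mn.
transitivity (\sum_(i < n.+1 | i == om) \sum_(t : bool | top_letters b (om, t))
  ps_weight x y u a b (i, t)).
  rewrite pair_big_dep /=; apply: eq_big => [[i t]|[i t] _] //.
  by rewrite /top_letters /=; case: eqP => //= _; rewrite eqxx.
rewrite big_pred1_eq big_mkcond big_bool /= /top_letters /= eqxx /=.
rewrite /forced_primed /strip_factor /ps_weight /= /strip_start in bl *.
case: ifP bl => im bl /=.
  have /and3P[q0 _ _] := rows_bounds im.
  have -> : (b.2 == 0%N :> nat) = false by rewrite gtn_eqF // (leq_trans q0).
  case: eqP => _ /=; last by rewrite add0r.
  by case: eqP => _ /=; rewrite ?addr0 //; ring.
by case: eqP => _; rewrite ?add0r // addrC.
Qed.

(** The value 1 is the empty strip; otherwise the starting box is followed by unprimed letters at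
    positions [qq + 1] to [pp - 1]. *)
Definition strip_row_weight (mm i p' pp qq : nat) : R :=
  if (qq < pp)%N then
    (if qq == p' then y mm - a qq else x mm + y mm) * apow a qq pp.-1 (x mm)
  else 1.

Lemma ps_top_sum :
  top_sum (@plevel n) (ord0, true) (@ps_compat n N) (ps_weight x y u a) m strip =
  (x m + u m) * apow a 0 (p m).-1 (x m) *
  \prod_(i < m) strip_row_weight m i (p i.+1) (p i) (q i).
Proof.
rewrite (top_sum_family _ top_tableau_primed).
under eq_bigr => b bS do rewrite sum_top_letters //.
rewrite (prod_skew_diagram (rows q) strip_factor mn); last first.
  by move=> i im; apply/ltnW/(row_lengths_lt hp).
congr (_ * _).
  rewrite big_ltn ?(row_lengths_ge hp) // /strip_factor ltnn eqxx; congr (_ * _).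
  by rewrite /apow big_add1.
apply: eq_bigr => i _; rewrite /strip_row_weight rowsE.
case: ifP => qp; last by rewrite big_geq // leqNgt qp.
rewrite big_ltn // /strip_factor ltn_ord rowsE eqxx; congr (_ * _).
rewrite /apow big_add1; apply: eq_big_nat => c /andP[c1 _].
by rewrite gtn_eqF.
Qed.

End PrimedTop.

Lemma ps_vandermonde (R : comNzRingType) n N (x y u a : nat -> R) m p :
  (m <= n.+1)%N -> row_lengths true N m p ->
  (\prod_(j < m) \prod_(i < j) (x i - x j)) * ps_sum n N x y u a m p =
  (\prod_(j < m) ((x j + u j) * \prod_(i < j) (x i + y j))) *
  \det (\matrix_(i < m, j < m) apow a 0 (expo true m j (p j)) (x i)).
Proof.
move=> mn hp.
rewrite (@vandermonde_branching R a n.+1 N true x (ps_sum n N x y u a)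
  (fun k => x k + u k) (fun k z => z + y k)
  (strip_row_weight x y a)) //.
- by move=> p'; apply: tableau_sum0.
- move=> k p' kn hp'; rewrite /ps_sum (@tableau_branching R _ _ true) //.
  + rewrite mulr_sumr; apply: eq_bigr => q /andP[q1 q2].
    by rewrite -/(strip n p' q) ps_top_sum // mulrC [RHS]mulrA.
  + exact: ps_compat_before.
  + exact: ps_compat_lt.
  + exact: ps_compat_diag.
- move=> k i p' q X ik kn; case: p' => // lo _; rewrite addn1.
  case: q => // hi; rewrite ltnS => lohi hiN.
  rewrite (@big_ord_interval _ _ _ N lo.+1 hi.+2 (fun c =>
    strip_row_weight x y a k i lo.+1 hi.+1 c * apow a 0 (expo true k i c) X)) // /expo /=.
  rewrite -apow_divided_difference 1?ltnW // mulrCA; congr (_ * _).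
  (* The three parts of [apow_strip_sum] are the new lengths [lo.+1], those strictly between, and
     [hi.+1], which removes nothing. *)
  rewrite -apow_strip_sum // big_add1 /= big_nat_recr /= 1?ltnW // big_ltn //.
  rewrite /strip_row_weight eqxx ltnn !ltnS lohi /= mul1r; congr (_ + _ + _).
  apply: eq_big_nat => c /andP[c1 c2].
  by rewrite ltnS c2 eqSS gtn_eqF.
Qed.

(** * Transfer to the fillings of diagrams *)

Lemma rmorph_tableau_sum (R R' : comNzRingType) (f : {rmorphism R -> R'}) n N
    (E : finType) (lv : E -> nat) e0 compat (wt : 'I_n * 'I_N -> E -> R) m p :
  f (tableau_sum lv e0 compat wt m p) =
  tableau_sum lv e0 compat (fun b e => f (wt b e)) m p.
Proof. by rewrite rmorph_sum; apply: eq_bigr => T _; rewrite rmorph_prod. Qed.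

Lemma eq_tableau_sum (R : comNzRingType) n N
    (E : finType) (lv : E -> nat) e0 compat (wt wt' : 'I_n * 'I_N -> E -> R) m p :
  wt =2 wt' -> tableau_sum lv e0 compat wt m p = tableau_sum lv e0 compat wt' m p.
Proof. by move=> h; apply: eq_bigr => T _; apply: eq_bigr => b _. Qed.

(** For [i < j] the difference is, up to sign, monic of degree [j + 1], hence regular over any ring.
    The exponent [i.+1] instead of [i] keeps the constant term equal to [x i]. *)
Lemma lreg_vandermonde_perturbed (R : comNzRingType) (x : nat -> R) m :
  let X i := (x i)%:P + 'X^(i.+1) in
  GRing.lreg (\prod_(j < m) \prod_(i < j) (X i - X j)).
Proof.
move=> X; apply: (big_ind (@GRing.lreg _)) => [|? ?|j _]; [exact: lreg1|exact: lregM|].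
apply: (big_ind (@GRing.lreg _)) => [|? ?|i _]; [exact: lreg1|exact: lregM|].
rewrite -[_ - _]opprB; apply/lregN/lreg_lead.
have -> : X j - X i = 'X^(j.+1) + ((x j - x i)%:P - 'X^(i.+1)).
  by rewrite /X polyCB; ring.
rewrite lead_coefDl ?lead_coefXn; first exact: lreg1.
rewrite size_polyXn ltnS (leq_trans (size_polyD _ _)) // size_polyN size_polyXn geq_max.
by rewrite (leq_trans (size_polyC_leq1 _)) //= ltnS.
Qed.

(** Since the exponents agree, both sums times the Vandermonde product involve the same determinant.
    The product is cancelled over R[t], and the morphism [horner_eval 0] brings the identity back to
    [R]. *)
Lemma ps_sum_factor (R : comNzRingType) n N (x y u a : nat -> R) p p' :
  row_lengths true N n.+1 p -> row_lengths false N n.+1 p' ->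
  (forall i, (i < n.+1)%N -> expo true n.+1 i (p i) = expo false n.+1 i (p' i)) ->
  ps_sum n N x y u a n.+1 p =
  (\prod_(j < n.+1) ((x j + u j) * \prod_(i < j) (x i + y j))) *
  ss_sum n N x a n.+1 p'.
Proof.
move=> hp hp' pp'.
pose X i := (x i)%:P + 'X^(i.+1).
pose y' i := (y i)%:P; pose u' i := (u i)%:P; pose a' i := (a i)%:P.
have E : ps_sum n N X y' u' a' n.+1 p =
  (\prod_(j < n.+1) ((X j + u' j) * \prod_(i < j) (X i + y' j))) *
  ss_sum n N X a' n.+1 p'.
  apply: (@lreg_vandermonde_perturbed R x n.+1); rewrite -/X.
  rewrite ps_vandermonde // mulrCA ss_vandermonde //; congr (_ * \det _).
  by apply/matrixP => i j; rewrite !mxE pp'.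
have X0 i : horner_eval 0 (X i) = x i.
  by rewrite /horner_eval /X hornerD hornerC hornerXn expr0n addr0.
clearbody X; have C0 c : horner_eval 0 c%:P = c by rewrite /horner_eval hornerC.
have := congr1 (horner_eval (0 : R)) E.
rewrite rmorphM rmorph_prod /ps_sum /ss_sum !rmorph_tableau_sum.
rewrite (@eq_tableau_sum _ _ _ _ _ _ _ _ (ps_weight x y u a)) => [->|b e]; last first.
  by rewrite /ps_weight /u' /y' /a'; do 2!case: ifP => _; rewrite ?rmorphB ?rmorphD /= ?X0 ?C0.
congr (_ * _).
  apply: eq_bigr => j _; rewrite rmorphM rmorphD rmorph_prod /= /u' X0 C0; congr (_ * _).
  by apply: eq_bigr => i _; rewrite rmorphD /= /y' X0 C0.
by apply: eq_tableau_sum => b e; rewrite /ss_weight rmorphD /= /a' X0 C0.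
Qed.

(** Along the injection [h], [push] extends a filling to the whole grid by [e0] and [pull] restricts
    it back. The lower bound on levels in [tableau] comes from [compatible_row_le]. *)
Lemma tableau_sum_transfer (R : comNzRingType) n N s (E : finType) (lv : E -> nat) (e0 : E)
    (compat : 'I_n * 'I_N -> 'I_n * 'I_N -> E -> E -> bool)
    (wt : 'I_n * 'I_N -> E -> R) m p (B : finType) (h : B -> 'I_n * 'I_N)
    (P : pred {ffun B -> E}) (F : {ffun B -> E} -> R) :
  row_lengths s N m p ->
  (forall (b b' d : 'I_n * 'I_N) (T : {ffun 'I_n * 'I_N -> E}),
    b'.1 = b.1 -> b'.2 = (b.2 + s)%N :> nat -> d.1 = b.1.+1 :> nat -> d.2 = b.2 ->
    compat b b' (T b) (T b') -> compat b' d (T b') (T d) -> (lv (T b) < lv (T d))%N) ->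
  (forall e, (lv e < m)%N) ->
  injective h -> (forall g, (g \in row_diagram n N m p) = (g \in codom h)) ->
  (forall T : {ffun B -> E},
     P T = [forall b, forall c, compat (h b) (h c) (T b) (T c)]) ->
  (forall T : {ffun B -> E}, F T = \prod_b wt (h b) (T b)) ->
  \sum_(T | P T) F T = tableau_sum lv e0 compat wt m p.
Proof.
move=> hp diag lvm h_inj codomh PE FE; rewrite /tableau_sum.
set S := row_diagram n N m p in codomh *.
have hS b : h b \in S by rewrite codomh codom_f.
pose pull (T : {ffun 'I_n * 'I_N -> E}) := [ffun b => T (h b)].
pose push (T : {ffun B -> E}) :=
  [ffun g => if [pick b | h b == g] is Some b then T b else e0].
have pushh (T : {ffun B -> E}) b : push T (h b) = T b.
  rewrite ffunE; case: pickP => [c /eqP/h_inj->//|/(_ b)].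
  by rewrite eqxx.
rewrite (reindex_onto pull push) => [|T _]; last first.
  by apply/ffunP => b; rewrite ffunE pushh.
apply: eq_big => [T|T _]; last first.
  rewrite FE (eq_bigl (fun g => g \in [set h b | b in B])).
    rewrite big_imset /=; last by move=> ? ? _ _ /h_inj.
    by apply: eq_bigr => b _; rewrite ffunE.
  by move=> g; rewrite codomh; apply/codomP/imsetP => -[b]; [exists b|move=> _; exists b].
rewrite PE; have -> : [forall b, forall c, compat (h b) (h c) (pull T b) (pull T c)] =
    compatible compat S T.
  apply/forallP/compatibleP => [H b c|H b].
    rewrite !codomh => /codomP[b' ->] /codomP[c' ->].
    by have /forallP/(_ c') := H b'; rewrite !ffunE.
  by apply/forallP => c; rewrite !ffunE; apply: H.
rewrite /tableau andbC; have [cT|] := boolP (compatible compat S T); last by rewrite !andbF.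
rewrite !andbT; apply/eqP/familyP => [<- g|H].
  rewrite /=; case: ifP => [gS|gS]; last first.
    rewrite !inE ffunE; case: pickP => // b /eqP e.
    by rewrite -e hS in gS.
  move: (gS); rewrite codomh => /codomP[b gb].
  rewrite !inE lvm andbT gb pushh ffunE.
  exact: (compatible_row_le (s := s) diag hp cT).
apply/ffunP => g; have [gS|gS] := boolP (g \in S).
  by move: gS; rewrite codomh => /codomP[b ->]; rewrite pushh ffunE.
have := H g; rewrite /= (negbTE gS) !inE => /eqP ->.
rewrite ffunE; case: pickP => // b /eqP e.
by rewrite -e hS in gS.
Qed.

(** * Membership in ordinary and shifted diagrams *)

Lemma plength_gt mu i : is_partition mu -> (i < plength mu)%N = (0 < nth 0%N mu i)%N.
Proof.
rewrite /is_partition /plength; elim: mu i => [|m mu IH] i.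
  by rewrite nth_nil.
move=> hmu; have smu := path_sorted hmu.
have geq_trans : transitive geq by move=> b c d h1 h2; apply: leq_trans h2 h1.
have /allP hall := order_path_min geq_trans hmu.
case: m hmu hall => [|m] _ hall /=; last by case: i => // i; rewrite add1n ltnS IH.
have z j : nth 0%N mu j = 0%N.
  have [jm|jm] := ltnP j (size mu); last by rewrite nth_default.
  by apply/eqP; have := hall _ (mem_nth 0%N jm); rewrite /= leqn0.
rewrite add0n IH // z; by case: i => //= i; rewrite z.
Qed.

Lemma mem_diagram mu z : is_partition mu ->
  (z \in diagram mu) = [&& (0 < z.1)%N, (0 < z.2)%N & (z.2.-1 < nth 0%N mu z.1.-1)%N].
Proof.
move=> hmu; case: z => i j /=; apply/allpairsPdep/and3P.
  move=> [i' [j' []]]; rewrite !mem_iota /part => /andP[i1 i2] /andP[j1 j2] [-> ->].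
  by split => //; case: j' j1 j2.
case: i j => [|i] [|j] [] //= _ _ h; exists i.+1, j.+1.
rewrite !mem_iota /part /= !add1n !ltnS; split => //.
by rewrite plength_gt // (leq_ltn_trans _ h).
Qed.

Lemma nth_staircase n mu i :
  nth 0%N (add_staircase n mu) i = if (i < n)%N then (nth 0%N mu i + (n - i))%N else 0%N.
Proof.
case: ltnP => h; last by rewrite nth_default // size_map size_iota.
rewrite (nth_map 0%N) ?size_iota // nth_iota // /part add1n /= addn1 subnSK //.
Qed.

Lemma plength_staircase n mu : plength (add_staircase n mu) = n.
Proof.
rewrite /plength /add_staircase count_map -[RHS](size_iota 1) -[RHS]count_predT.
by apply: eq_in_count => i _ /=; rewrite addn1 addnS.
Qed.

Lemma strict_staircase n mu : is_partition mu -> is_strict_partition (add_staircase n mu).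
Proof.
move=> hmu; rewrite /is_strict_partition.
apply/(sortedP 0%N) => i; rewrite size_map size_iota => im.
rewrite !nth_staircase im (ltnW im) /=.
have le : (nth 0%N mu i.+1 <= nth 0%N mu i)%N.
  have [imu|imu] := ltnP i.+1 (size mu); last by rewrite nth_default.
  exact: (sortedP 0%N hmu).
by rewrite -addnS leq_add // subnSK // ltnW.
Qed.

Lemma mem_shifted_diagram n mu z :
  (z \in shifted_diagram (add_staircase n mu)) =
  [&& (0 < z.1 <= n)%N, (z.1 <= z.2)%N &
      (z.2 - z.1 < nth 0%N mu z.1.-1 + (n - z.1.-1))%N].
Proof.
case: z => i j /=; rewrite /shifted_diagram plength_staircase.
apply/allpairsPdep/and3P.
  move=> [i' [j' []]]; rewrite !mem_iota /part nth_staircase => /andP[i1 i2] + [-> ->].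
  case: i' i1 i2 => // i' _; rewrite add1n ltnS /= => i2; rewrite i2 => /andP[j1 j2].
  by split=> //; rewrite ltn_subLR.
move=> [/andP[i1 i2] ij h]; exists i, j.
rewrite !mem_iota /part nth_staircase i1 add1n ltnS i2 ij /= prednK // i2.
by rewrite -ltn_subLR.
Qed.

Lemma partition_row_lengths n N mu : is_partition mu ->
  (forall i, (i < n)%N -> (nth 0%N mu i < N)%N) -> row_lengths false N n (nth 0%N mu).
Proof.
move=> hmu hN; apply/forallP => i; rewrite hN // addn0; apply/implyP => _.
have [imu|imu] := ltnP i.+1 (size mu); last by rewrite nth_default.
exact: (sortedP 0%N hmu).
Qed.

Lemma factorial_schur_ss_sum (R : comNzRingType) n N mu (x : 'I_n.+1 -> R) a :
  is_partition mu -> (plength mu <= n.+1)%N ->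
  (forall i, (i < n.+1)%N -> (nth 0%N mu i < N.+1)%N) ->
  factorial_schur mu x a =
  ss_sum n N.+1 (fun i => x (inord i)) a n.+1 (nth 0%N mu).
Proof.
move=> hmu lmu hN; have hp := partition_row_lengths hmu hN.
pose h (b : seq_sub (diagram mu)) : 'I_n.+1 * 'I_N.+1 :=
  (inord (brow b).-1, inord (bcol b).-1).
have hb b : [/\ brow b = (h b).1.+1 :> nat, bcol b = (h b).2.+1 :> nat
    & h b \in row_diagram n.+1 N.+1 n.+1 (nth 0%N mu)].
  have := valP b; rewrite mem_diagram // -/(brow b) -/(bcol b) => /and3P[b1 b2 b3].
  have b1n : ((brow b).-1 < n.+1)%N.
    by apply: leq_trans lmu; rewrite plength_gt // (leq_ltn_trans _ b3).
  have b2n : ((bcol b).-1 < N.+1)%N by apply: ltn_trans b3 (hN _ b1n).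
  split; [by rewrite inordK // prednK | by rewrite inordK // prednK |].
  by rewrite inE /= !inordK // b1n.
rewrite /factorial_schur /ss_sum.
apply: (@tableau_sum_transfer R _ _ false _ _ _ _ _ _ _ _ h) => //.
- exact: ss_compat_diag.
- move=> b c e; apply/val_inj.
  have [b1 b2 _] := hb b; have [c1 c2 _] := hb c.
  rewrite [val b]surjective_pairing [val c]surjective_pairing.
  by rewrite -/(brow b) -/(bcol b) -/(brow c) -/(bcol c) b1 b2 c1 c2 e.
- move=> [i c]; apply/idP/codomP => [|[b ->]]; last by have [] := hb b.
  rewrite inE /= => /andP[g1 g2].
  have gD : (i.+1, c.+1) \in diagram mu by rewrite mem_diagram.
  exists (SeqSub gD); rewrite /h /brow /bcol /=.
  by congr (_, _); apply/val_inj; rewrite /= inordK.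
- move=> T; apply: eq_forallb => b; apply: eq_forallb => c.
  have [-> -> _] := hb b; have [-> -> _] := hb c.
  by rewrite /ss_compat !eqSS !ltnS !val_eqE.
- move=> T; apply: eq_bigr => b _; have [-> -> _] := hb b.
  by rewrite /ss_weight inord_val addnS subSS.
Qed.

(** Box (i, j) goes to row i - 1 and position j - i. The weight [u] of diagonal primes is kept free,
    so that the P- and Q-functions are both instances. *)
Lemma shifted_sum_ps_sum (R : comNzRingType) n N mu (x y u : 'I_n.+1 -> R) a :
  is_partition mu ->
  let p i := (nth 0%N mu i + (n.+1 - i))%N in
  (forall i, (i < n.+1)%N -> (p i < N.+1)%N) ->
  row_lengths true N.+1 n.+1 p /\
  \sum_(T : filling (shifted_diagram (add_staircase n.+1 mu)) (pletter n.+1) |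
         is_Qtableau T)
    \prod_b
      (let k := (T b).1 in
       if brow b == bcol b then (if primed (T b) then u k else x k)
       else if primed (T b) then y k - a (bcol b - brow b)%N
       else x k + a (bcol b - brow b)%N) =
  ps_sum n N.+1 (fun i => x (inord i)) (fun i => y (inord i))
    (fun i => u (inord i)) a n.+1 p.
Proof.
move=> hmu p hN.
have hp : row_lengths true N.+1 n.+1 p.
  have /forallP hs := partition_row_lengths hmu (N := (\max_(i < n.+1) nth 0 mu i).+1) (n := n.+1)
    (fun i im => leq_bigmax (Ordinal im)).
  apply/forallP => i; rewrite hN //= /p addn_gt0 subn_gt0 ltn_ord orbT /=.
  have /and3P[_ _ /implyP h] := hs i.
  by apply/implyP => im; have := h im; lia.
split=> //; set D := shifted_diagram _.
pose h (b : seq_sub D) : 'I_n.+1 * 'I_N.+1 :=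
  (inord (brow b).-1, inord (bcol b - brow b)).
have hb b : [/\ brow b = (h b).1.+1 :> nat, bcol b = (column true (h b)).+1 :> nat,
    (bcol b - brow b)%N = (h b).2 :> nat & h b \in row_diagram n.+1 N.+1 n.+1 p].
  have := valP b; rewrite mem_shifted_diagram -/(brow b) -/(bcol b).
  move=> /and3P[/andP[b1 b1'] b2 b3].
  have b1n : ((brow b).-1 < n.+1)%N by rewrite prednK.
  have b2n : (bcol b - brow b < N.+1)%N by apply: ltn_trans b3 (hN _ b1n).
  rewrite inE /column /= !inordK // mul1n prednK //; split => //.
    by rewrite -addnS prednK // subnK.
  by rewrite b1'.
rewrite /ps_sum.
apply: (@tableau_sum_transfer R _ _ true _ _ _ _ _ _ _ _ h) => //.
- exact: ps_compat_diag.
- by move=> e; rewrite /plevel.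
- move=> b c e; apply/val_inj.
  have [b1 b2 _ _] := hb b; have [c1 c2 _ _] := hb c.
  rewrite [val b]surjective_pairing [val c]surjective_pairing.
  by rewrite -/(brow b) -/(bcol b) -/(brow c) -/(bcol c) b1 b2 c1 c2 e.
- move=> [i c]; apply/idP/codomP => [|[b ->]]; last by have [] := hb b.
  rewrite inE /= => /andP[g1 g2].
  have gD : (i.+1, (c + i).+1) \in D.
    by rewrite mem_shifted_diagram /= g1 ltnS leq_addl subSS addnK.
  exists (SeqSub gD); rewrite /h /brow /bcol /=.
  by congr (_, _); apply/val_inj; rewrite /= inordK // subSS addnK.
- move=> T; apply: eq_forallb => b; apply: eq_forallb => c.
  have eqbc : (b == c) = (h b == h c).
    apply/eqP/eqP => [->//|e]; apply/val_inj.
    have [b1 b2 _ _] := hb b; have [c1 c2 _ _] := hb c.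
    rewrite [val b]surjective_pairing [val c]surjective_pairing.
    by rewrite -/(brow b) -/(bcol b) -/(brow c) -/(bcol c) b1 b2 c1 c2 e.
  rewrite eqbc; have [-> -> _ _] := hb b; have [-> -> _ _] := hb c.
  rewrite /ps_compat !eqSS !ltnS !val_eqE.
  case: (altP ((h b).1 =P (h c).1)) => [e|_] //=.
  by rewrite /column e ltn_add2r.
- move=> T; apply: eq_bigr => b _; rewrite /ps_weight !inord_val.
  have -> : (brow b == bcol b) = ((h b).2 == 0%N :> nat).
    have [-> -> _ _] := hb b; rewrite eqSS /column mul1n.
    by rewrite -{1}[X in X == _]add0n eqn_add2r eq_sym.
  by have [_ _ -> _] := hb b.
Qed.

Lemma factorial_Q_ps_sum (R : comNzRingType) n N mu (x y : 'I_n.+1 -> R) a :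
  is_partition mu ->
  let p i := (nth 0%N mu i + (n.+1 - i))%N in
  (forall i, (i < n.+1)%N -> (p i < N.+1)%N) ->
  factorial_Q (add_staircase n.+1 mu) x y a =
  ps_sum n N.+1 (fun i => x (inord i)) (fun i => y (inord i))
    (fun i => y (inord i)) a n.+1 p.
Proof. by move=> hmu p hN; have [_ <-] := shifted_sum_ps_sum x y y a hmu hN. Qed.

(** With [u] equal to 0, a prime on the diagonal makes the whole weight vanish, so the sum over all
    primed tableaux reduces to those without diagonal primes. *)
Lemma factorial_P_ps_sum (R : comNzRingType) n N mu (x y : 'I_n.+1 -> R) a :
  is_partition mu ->
  let p i := (nth 0%N mu i + (n.+1 - i))%N in
  (forall i, (i < n.+1)%N -> (p i < N.+1)%N) ->
  factorial_P (add_staircase n.+1 mu) x y a =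
  ps_sum n N.+1 (fun i => x (inord i)) (fun i => y (inord i)) (fun=> 0) a n.+1 p.
Proof.
move=> hmu p hN; have [_ <-] := shifted_sum_ps_sum x y (fun=> 0) a hmu hN.
rewrite /factorial_P big_mkcondr /=; apply: eq_bigr => T _.
case: ifP => [/forallP hT|/negbT].
  apply: eq_bigr => b _ /=; case: ifP => // bb.
  by have := hT b; rewrite bb /= => /negbTE ->.
rewrite negb_forall => /existsP[b]; rewrite negb_imply negbK => /andP[bb pb].
by rewrite (bigD1 b) //= bb pb mul0r.
Qed.

Theorem theorem1 (R : comNzRingType) (n : nat) (mu : seq nat)
    (x y : 'I_n -> R) (a : nat -> R) :
  (1 <= n)%N -> is_partition mu -> (plength mu <= n)%N ->
  let la := add_staircase n mu in
  [/\ is_strict_partition la,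
      plength la = n,
      factorial_P la x y a =
        (\prod_(i < n) x i)
        * (\prod_(i < n) \prod_(j < n | (i < j)%N) (x i + y j))
        * factorial_schur mu x a
    & factorial_Q la x y a =
        (\prod_(i < n) \prod_(j < n | (i <= j)%N) (x i + y j))
        * factorial_schur mu x a].
Proof.
case: n x y => // n x y _ hmu lmu la.
pose p i := (nth 0%N mu i + (n.+1 - i))%N.
pose N := \max_(i < n.+1) p i.
have hN i : (i < n.+1)%N -> (p i < N.+1)%N.
  by move=> im; exact: (leq_bigmax (Ordinal im)).
have hN' i : (i < n.+1)%N -> (nth 0%N mu i < N.+1)%N.
  by move=> im; apply: leq_ltn_trans (hN i im); rewrite leq_addr.
have [hp _] := shifted_sum_ps_sum x y y a hmu hN.
have hp' := partition_row_lengths hmu hN'.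
(* Both exponents equal mu_i + n - i, with rows counted from 0. *)
have pp i : (i < n.+1)%N -> expo true n.+1 i (p i) = expo false n.+1 i (nth 0%N mu i).
  by move=> im; rewrite /expo /p; lia.
have prodE : \prod_(j < n.+1) \prod_(i < j) (x (inord i) + y (inord j)) =
    \prod_(i < n.+1) \prod_(j < n.+1 | (i < j)%N) (x i + y j).
  rewrite [RHS](exchange_big_dep xpredT) //=; apply: eq_bigr => j _.
  rewrite (big_ord_widen n.+1 (fun i => x (inord i) + y (inord j)) (ltnW (ltn_ord j))).
  by apply: eq_bigr => i _; rewrite !inord_val.
split; [exact: strict_staircase | exact: plength_staircase
  | rewrite (factorial_P_ps_sum _ _ _ hmu hN)
  | rewrite (factorial_Q_ps_sum _ _ _ hmu hN)].
all: rewrite (factorial_schur_ss_sum _ _ hmu lmu hN') (ps_sum_factor _ _ _ _ hp hp' pp).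
all: rewrite big_split /= prodE; congr (_ * _).
  by congr (_ * _); apply: eq_bigr => i _; rewrite addr0 inord_val.
(* The factors x_i + y_i, which come from the diagonal boxes, are the terms j = i of the product
   over i <= j. *)
rewrite -big_split /=; apply: eq_bigr => i _.
rewrite [RHS](bigD1 i) //= !inord_val; congr (_ * _); apply: eq_bigl => j.
by rewrite ltn_neqAle andbC eq_sym.
Qed.
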